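(* Let $n\ge 1$ and let $\mathcal S_n$ denote the $\mathbb Q$-vector space of symmetric $n\times n$ matrices with entries in $\mathbb Q$. The set $\operatorname{trop}(\Sigma_n^* )$ consists exactly of those matrices $[a_{ij}]\in\mathcal S_n$ for which the minimum in the tropical determinant $\min_{\sigma\in S_n}(a_{1\sigma(1)}+\cdots+a_{n\sigma(n)})$ is attained at the identity permutation. Moreover, $\operatorname{trop}(\Sigma_n^* )$ is a closed polyhedral cone in $\mathcal S_n$ defined by the inequalities $$x_{ii}+x_{jj}\le 2x_{ij}\quad\text{for all } i\neq j,$$ and it is generated as a cone by the rays $\{e_{ij}: i\neq j\}$ together with a lineality space spanned by $\{2e_{ii}+\sum_{j\neq i}e_{ij} : 1\le i\le n\}$.
   Context: Let $R=\bigcup_{m\ge1}\mathbb R((t^{1/m}))$ be the field of real Puiseux series, with valuation $\operatorname{val}:R\setminus\{0\}\to\mathbb Q$ giving the lowest exponent of $t$ appearing with nonzero coefficient; $R$ is ordered by $a>b$ iff the leading coefficient of $a-b$ is positive. $\operatorname{val}$ is applied coordinatewise to vectors/matrices with nonzero entries. $\Sigma_n$ is the set of $n\times n$ symmetric matrices over $R$ all of whose principal minors are nonnegative (PSD matrices), $\Sigma_n^*$ is the subset of those with no zero entries, and $\operatorname{trop}(\Sigma_n^* )=\{\operatorname{val}(A):A\in\Sigma_n^*\}$, a subset of the rational symmetric $n\times n$ matrices. Its elements are called tropical PSD matrices. For $1\le i,j\le n$, $e_{ij}$ is the symmetric matrix with $1$ in entries $(i,j)$ and $(j,i)$ and $0$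 elsewhere (so $e_{ii}$ has a single $1$ at $(i,i)$). $S_n$ is the symmetric group on $\{1,\dots,n\}$. *)

(* Defs.v *)
From HB Require Import structures.
From mathcomp Require Import all_boot all_order all_fingroup all_algebra.
From mathcomp Require Import all_classical all_reals all_analysis.
From mathcomp Require Import zify lra.

Set Implicit Arguments.
Unset Strict Implicit.
Unset Printing Implicit Defensive.

Import Order.TTheory GRing.Theory Num.Theory.
Import numFieldNormedType.Exports.

Local Open Scope classical_set_scope.
Local Open Scope ring_scope.

(* A Puiseux series over [K] is a formal sum [\sum_q f q t^q] over rational
   exponents [q], given by its coefficient function [f : rat -> K]. It lies in
   [K((t^{1/m}))] iff every exponent is of the form [k / m] with [k] an integer
   (i.e. [q * m] is an integer), and the exponents are bounded below. *)

Definition laurent_root (K : nmodType) (m : nat) (f : rat -> K) : Prop :=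
  exists L : rat, forall q, f q != 0 -> q * m%:R \is a Num.int /\ L <= q.

Record puiseux (K : nmodType) := Puiseux {
  pcoef :> rat -> K;
  pcoefP : exists2 m, (0 < m)%N & laurent_root m pcoef }.

HB.instance Definition _ (K : nmodType) := gen_eqMixin (puiseux K).
HB.instance Definition _ (K : nmodType) := gen_choiceMixin (puiseux K).

Lemma puiseux_eqP (K : nmodType) (f g : puiseux K) : f =1 g -> f = g.
Proof.
case: f g => [f fP] [g gP] /= /funext fg.
by move: fP gP; rewrite fg => fP gP; congr Puiseux; apply: Prop_irrelevance.
Qed.

Lemma grid_mul (m n : nat) (q : rat) :
  q * m%:R \is a Num.int -> q * (m * n)%:R \is a Num.int.
Proof. by move=> qm; rewrite natrM mulrA rpredM ?rpred_nat. Qed.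

Lemma laurent_rootM (K : nmodType) (m n : nat) (f : rat -> K) :
  laurent_root m f -> laurent_root (m * n) f.
Proof. by case=> L fL; exists L => q /fL[qm Lq]; rewrite grid_mul. Qed.

Lemma puiseux_grid2 (K : nmodType) (f g : puiseux K) :
  exists m (L : rat), [/\ (0 < m)%N, L <= 0,
   forall q, f q != 0 -> q * m%:R \is a Num.int /\ L <= q &
   forall q, g q != 0 -> q * m%:R \is a Num.int /\ L <= q].
Proof.
have [m m0 fm] := pcoefP f; have [n n0 gn] := pcoefP g.
have [A fA] := laurent_rootM n fm.
have := laurent_rootM m gn; rewrite mulnC => -[B gB].
exists (m * n)%N, (Order.min (Order.min A B) 0); split.
- by rewrite muln_gt0 m0.
- by rewrite ge_min lexx orbT.
- by move=> q /fA[-> Aq]; rewrite !ge_min Aq.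
- by move=> q /gB[-> Aq]; rewrite !ge_min Aq orbT.
Qed.

Lemma puiseux_grid3 (K : nmodType) (f g h : puiseux K) :
  exists m (L : rat), [/\ (0 < m)%N, L <= 0,
   forall q, f q != 0 -> q * m%:R \is a Num.int /\ L <= q,
   forall q, g q != 0 -> q * m%:R \is a Num.int /\ L <= q &
   forall q, h q != 0 -> q * m%:R \is a Num.int /\ L <= q].
Proof.
have [m [A [m0 A0 fA gA]]] := puiseux_grid2 f g.
have [n n0 hn] := pcoefP h.
have := laurent_rootM m hn; rewrite mulnC => -[B hB].
exists (m * n)%N, (Order.min A B); split.
- by rewrite muln_gt0 m0.
- by rewrite ge_min A0.
- by move=> q /fA[qm Aq]; rewrite grid_mul// ge_min Aq.
- by move=> q /gA[qm Aq]; rewrite grid_mul// ge_min Aq.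
- by move=> q /hB[-> Aq]; rewrite ge_min Aq orbT.
Qed.

Lemma grid_window (m : nat) (A B : rat) : (0 < m)%N ->
  exists2 s : seq rat, uniq s &
    forall q, q * m%:R \is a Num.int -> A <= q -> q <= B -> q \in s.
Proof.
move=> m0; have m0' : (0 : rat) < m%:R by rewrite ltr0n.
pose M := Order.max `|A| `|B| * m%:R.
have M0 : 0 <= M by rewrite mulr_ge0 ?le_max ?normr_ge0// ltW.
pose n := Num.bound M.
have MleN : M < n%:R by exact: archi_boundP.
exists (undup [seq (i%:Z - n%:Z)%:~R / m%:R : rat | i <- iota 0 n.*2.+1]).
  exact: undup_uniq.
move=> q /intrP[k qk] Aq qB; rewrite mem_undup.
have kM : `|k%:~R| <= M :> rat.
  rewrite -qk normrM (gtr0_norm m0') ler_pM2r//.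
  have := ler_norm (- A); have := ler_norm B; rewrite normrN => BB AA.
  rewrite ler_norml lerNl !le_max; apply/andP; split; apply/orP.
    by left; lra.
  by right; lra.
have : `|k| <= n%:Z.
  rewrite -(ler_int rat) intr_norm; exact: le_trans kM (ltW MleN).
rewrite ler_norml => /andP[k1 k2].
have kn0 : 0 <= k + n%:Z by rewrite -lerBlDr sub0r.
apply/mapP; exists (absz (k + n%:Z)).
  rewrite mem_iota leq0n add0n ltnS -lez_nat gez0_abs// -addnn PoszD lerD2r//.
by rewrite gez0_abs// addrK -qk mulfK// gt_eqF.
Qed.

Section Zmodule.
Variable K : zmodType.

Lemma puiseux_zero_subproof :
  exists2 m, (0 < m)%N & laurent_root m (fun _ => 0 : K).
Proof. by exists 1%N => //; exists 0 => q; rewrite eqxx. Qed.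
Definition puiseux_zero : puiseux K := Puiseux puiseux_zero_subproof.

Lemma puiseux_opp_subproof (f : puiseux K) :
  exists2 m, (0 < m)%N & laurent_root m (fun q => - f q).
Proof.
have [m m0 [L fL]] := pcoefP f; exists m => //; exists L => q.
by rewrite oppr_eq0 => /fL.
Qed.
Definition puiseux_opp f : puiseux K := Puiseux (puiseux_opp_subproof f).

Lemma puiseux_add_subproof (f g : puiseux K) :
  exists2 m, (0 < m)%N & laurent_root m (fun q => f q + g q).
Proof.
have [m [L [m0 _ fL gL]]] := puiseux_grid2 f g; exists m => //; exists L => q.
have [f0|/fL//] := eqVneq (f q) 0; have [g0|/gL//] := eqVneq (g q) 0.
by rewrite f0 g0 addr0 eqxx.
Qed.
Definition puiseux_add f g : puiseux K := Puiseux (puiseux_add_subproof f g).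

Fact puiseux_addA : associative puiseux_add.
Proof. by move=> f g h; apply: puiseux_eqP => q /=; rewrite addrA. Qed.
Fact puiseux_addC : commutative puiseux_add.
Proof. by move=> f g; apply: puiseux_eqP => q /=; rewrite addrC. Qed.
Fact puiseux_add0 : left_id puiseux_zero puiseux_add.
Proof. by move=> f; apply: puiseux_eqP => q /=; rewrite add0r. Qed.
Fact puiseux_addN : left_inverse puiseux_zero puiseux_opp puiseux_add.
Proof. by move=> f; apply: puiseux_eqP => q /=; rewrite addNr. Qed.

HB.instance Definition _ := GRing.isZmodule.Build (puiseux K)
  puiseux_addA puiseux_addC puiseux_add0 puiseux_addN.

Lemma pcoef0 q : (0 : puiseux K) q = 0. Proof. by []. Qed.
Lemma pcoefN (f : puiseux K) q : (- f) q = - f q. Proof. by []. Qed.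
Lemma pcoefD (f g : puiseux K) q : (f + g) q = f q + g q. Proof. by []. Qed.
Lemma pcoefB (f g : puiseux K) q : (f - g) q = f q - g q. Proof. by []. Qed.

End Zmodule.

Section Field.
Variable K : fieldType.
Implicit Types f g h : puiseux K.

(* The sum over all rationals has finite support, see [conv_window]. *)
Definition conv (f g : rat -> K) (q : rat) : K :=
  \sum_(a \in [set: rat]) f a * g (q - a).

Lemma convE (s : seq rat) (f g : rat -> K) q : uniq s ->
  (forall a, f a != 0 -> g (q - a) != 0 -> a \in s) ->
  conv f g q = \sum_(a <- s) f a * g (q - a).
Proof.
move=> us fgs; rewrite /conv [RHS]fsbig_seq//; apply/esym/fsbig_widen => // a [_ /= as_].
apply: contrapT => /eqP; rewrite mulf_eq0 negb_or => /andP[fa ga].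
exact/as_/fgs.
Qed.

Lemma conv_window m (L A B : rat) : (0 < m)%N ->
  exists2 s : seq rat, uniq s &
   forall f g : rat -> K,
   (forall q, f q != 0 -> q * m%:R \is a Num.int /\ L <= q) ->
   (forall q, g q != 0 -> q * m%:R \is a Num.int /\ A <= q) ->
   forall q, q <= B -> forall a, f a != 0 -> g (q - a) != 0 -> a \in s.
Proof.
move=> /(grid_window L (B - A))[s us sP]; exists s => // f g fL gA q qB a.
move=> /fL[am La] /gA[_]; rewrite lerBrDr -lerBrDl => aqA.
by apply: sP => //; rewrite (le_trans aqA)// lerB.
Qed.

Lemma conv_grid m (L A : rat) (f g : rat -> K) :
  (forall q, f q != 0 -> q * m%:R \is a Num.int /\ L <= q) ->
  (forall q, g q != 0 -> q * m%:R \is a Num.int /\ A <= q) ->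
  forall q, conv f g q != 0 -> q * m%:R \is a Num.int /\ L + A <= q.
Proof.
move=> fL gA q; apply: contra_neqP => nq; rewrite /conv fsbig1// => a _.
apply/eqP; rewrite mulf_eq0; apply: contra_notT nq.
rewrite negb_or => /andP[/fL[am La] /gA[qam Aqa]]; split.
  by rewrite -(subrK a q) mulrDl rpredD.
by rewrite -(subrKC a q) lerD.
Qed.

Lemma puiseux_one_subproof :
  exists2 m, (0 < m)%N & laurent_root m (fun q => (q == 0)%:R : K).
Proof.
exists 1%N => //; exists 0 => q.
by have [->|] := eqVneq q 0; rewrite ?mul0r ?rpred0// eqxx.
Qed.
Definition puiseux_one : puiseux K := Puiseux puiseux_one_subproof.

Lemma puiseux_mul_subproof f g :
  exists2 m, (0 < m)%N & laurent_root m (conv f g).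
Proof.
have [m [L [m0 _ fL gL]]] := puiseux_grid2 f g; exists m => //; exists (L + L).
exact: conv_grid.
Qed.
Definition puiseux_mul f g : puiseux K := Puiseux (puiseux_mul_subproof f g).

Fact puiseux_mulA : associative puiseux_mul.
Proof.
move=> f g h; apply: puiseux_eqP => q.
have [m [L [m0 L0 fL gL hL]]] := puiseux_grid3 f g h.
have [s us sP] := grid_window (L + L) (q - L - L) m0.
have win a b : f a != 0 -> g (b - a) != 0 -> h (q - b) != 0 ->
    (a \in s) && (b \in s).
  move=> /fL[am La] /gL[bam Lb] /hL[qbm Lq].
  have bm : b * m%:R \is a Num.int by rewrite -(subrK a b) mulrDl rpredD.
  by apply/andP; split; apply: sP => //; lra.
rewrite /= (convE us); last first.
  move=> a /fL[am La] /(conv_grid gL hL)[_ La'].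
  by apply: sP => //; lra.
rewrite (convE us); last first.
  move=> b /(conv_grid fL gL)[bm Lb] /hL[_ Lq].
  by apply: sP => //; lra.
transitivity (\sum_(b <- s) \sum_(a <- s) f a * g (b - a) * h (q - b)); last first.
  apply: eq_bigr => b _; have [->|hb] := eqVneq (h (q - b)) 0.
    by rewrite mulr0 big1// => a _; rewrite mulr0.
  rewrite (convE us) ?mulr_suml// => a fa ga.
  by have /andP[] := win _ _ fa ga hb.
rewrite exchange_big; apply: eq_bigr => a _.
have [->|fa] := eqVneq (f a) 0.
  by rewrite mul0r big1// => b _; rewrite !mul0r.
rewrite (@convE [seq b - a | b <- s]).
- rewrite mulr_sumr big_map; apply: eq_bigr => b _.
  by rewrite mulrA opprB addrA subrK.
- by rewrite map_inj_uniq//; apply: addIr.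
- move=> c gc hc; apply/mapP; exists (c + a); rewrite ?addrK//.
  suff /andP[] : (a \in s) && (c + a \in s) by [].
  by apply: win => //; rewrite ?addrK// opprD addrA addrAC.
Qed.

Fact puiseux_mulC : commutative puiseux_mul.
Proof.
move=> f g; apply: puiseux_eqP => q /=.
have [m [L [m0 L0 fL gL]]] := puiseux_grid2 f g.
have [s us sP] := conv_window L L q m0.
rewrite (convE us (sP _ _ fL gL _ (lexx _))).
rewrite (@convE [seq q - a | a <- s]).
- by rewrite big_map; apply: eq_bigr => a _; rewrite subKr mulrC.
- by rewrite map_inj_uniq//; apply: subrI.
- move=> a ga fa; apply/mapP; exists (q - a); rewrite ?subKr//.
  by apply: (sP _ _ fL gL _ (lexx _)) => //; rewrite subKr.
Qed.

Fact puiseux_mul1 : left_id puiseux_one puiseux_mul.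
Proof.
move=> f; apply: puiseux_eqP => q /=; rewrite (@convE [:: 0])//.
  by rewrite big_seq1 eqxx mul1r subr0.
by move=> a; rewrite inE; case: (a == 0); rewrite ?eqxx.
Qed.

Fact puiseux_mulDl : left_distributive puiseux_mul +%R.
Proof.
move=> f g h; apply: puiseux_eqP => q; rewrite pcoefD /=.
have [m [L [m0 L0 fL gL hL]]] := puiseux_grid3 f g h.
have [s us sP] := conv_window L L q m0.
rewrite (convE us (sP _ _ fL hL _ (lexx _))).
rewrite (convE us (sP _ _ gL hL _ (lexx _))).
rewrite (convE us); last first.
  apply: (sP _ _ _ hL _ (lexx _)) => a /=.
  have [f0|/fL//] := eqVneq (f a) 0; have [g0|/gL//] := eqVneq (g a) 0.
  by rewrite f0 g0 addr0 eqxx.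
by rewrite -big_split /=; apply: eq_bigr => a _; rewrite -mulrDl.
Qed.

Fact puiseux_1neq0 : puiseux_one != 0.
Proof.
by apply/eqP => /(congr1 (fun f : puiseux K => f 0))/eqP; rewrite pcoef0 oner_eq0.
Qed.

HB.instance Definition _ := GRing.Zmodule_isComNzRing.Build (puiseux K)
  puiseux_mulA puiseux_mulC puiseux_mul1 puiseux_mulDl puiseux_1neq0.

Lemma pcoef1 q : (1 : puiseux K) q = (q == 0)%:R. Proof. by []. Qed.
Lemma pcoefM f g q :
  (f * g) q = \sum_(a \in [set: rat]) f a * g (q - a).
Proof. by []. Qed.

Definition is_val (f : rat -> K) (q : rat) : Prop :=
  f q != 0 /\ forall r, r < q -> f r = 0.

(* By convention [pval 0 = 0]. *)
Definition pval f : rat := xget 0 (is_val f).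

Lemma is_val_exists f : f != 0 -> exists q, is_val f q.
Proof.
move=> f0; have [m m0 [L fL]] := pcoefP f.
have m0' : (0 : rat) < m%:R by rewrite ltr0n.
have [q fq] : exists q, f q != 0.
  apply/not_existsP => nf; move/eqP: f0; apply; apply: puiseux_eqP => q.
  by apply/eqP; apply: contrapT => /negP/nf.
pose P n := `[< f (q - n%:R / m%:R) != 0 >].
have exP : exists n, P n by exists 0%N; apply/asboolP; rewrite mul0r subr0.
have bndP n : P n -> (n <= Num.bound ((q - L) * m%:R))%N.
  move=> /asboolP/fL[_]; rewrite lerBrDr -lerBrDl ler_pdivrMr// => nq.
  rewrite -(ler_nat rat) (le_trans nq)// ltW// archi_boundP//.
  exact: le_trans nq.
case: (ex_maxnP exP bndP) => n /asboolP fn maxn; exists (q - n%:R / m%:R).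
split=> // r rn; apply/eqP; apply: contrapT => /negP fr.
have [qm _] := fL _ fq; have [rm _] := fL _ fr.
have /natrP[k kE] : (q - r) * m%:R \is a Num.nat.
  rewrite natrEint mulrBl rpredB//= -mulrBl mulr_ge0// ?subr_ge0 ltW//.
  by rewrite (lt_le_trans rn)// gerBl divr_ge0.
have rE : r = q - k%:R / m%:R by rewrite -kE mulfK ?gt_eqF// subKr.
have /maxn : P k by apply/asboolP; rewrite -rE.
move: rn; rewrite rE ltrD2l ltrN2 ltr_pM2r ?invr_gt0// ltr_nat => nk.
by rewrite leqNgt nk.
Qed.

Lemma pvalP f : f != 0 -> is_val f (pval f).
Proof. by move=> /is_val_exists[q fq]; apply: (xgetPex 0); exists q. Qed.

Lemma is_val_uniq (f : rat -> K) q r : is_val f q -> is_val f r -> q = r.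
Proof.
move=> [fq q0] [fr r0]; have [/r0 f0|/q0 f0|//] := ltgtP q r.
  by rewrite f0 eqxx in fq.
by rewrite f0 eqxx in fr.
Qed.

Lemma is_val_neq0 f q : is_val f q -> f != 0.
Proof. by case=> fq _; apply: contra_neq fq => ->. Qed.

Lemma pvalE f q : is_val f q -> pval f = q.
Proof. by move=> fq; apply: is_val_uniq (pvalP (is_val_neq0 fq)) fq. Qed.

Lemma convol_inverse (u : nat -> K) : u 0%N != 0 ->
  exists w : nat -> K, forall n, \sum_(i < n.+1) u i * w (n - i)%N = (n == 0%N)%:R.
Proof.
move=> u0.
pose step (s : seq K) : K :=
  ((size s == 0%N)%:R - \sum_(i < size s) u i.+1 * s`_(size s - i.+1)) / u 0%N.
pose W := fix W n := if n is n'.+1 then rcons (W n') (step (W n')) else [::].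
have sW n : size (W n) = n by elim: n => //= n IH; rewrite size_rcons IH.
have WE n k : (k < n)%N -> (W n)`_k = step (W k).
  elim: n => // n IH; rewrite ltnS leq_eqVlt /= nth_rcons sW => /predU1P[->|kn].
    by rewrite ltnn eqxx.
  by rewrite kn IH.
exists (fun n => step (W n)) => n.
rewrite big_ord_recl subn0 {1}/step sW mulrCA divff// mulr1.
rewrite [X in _ - X + _](_ : _ = \sum_(i < n) u i.+1 * step (W (n - i.+1)%N)).
  by rewrite subrK.
by apply: eq_bigr => i _; rewrite WE// ltn_subrL/= (leq_trans _ (ltn_ord i)).
Qed.

Lemma puiseux_inverse f : f != 0 -> exists g, g * f = 1.
Proof.
move=> /pvalP; set v := pval f => -[fv f0].
have [m m0 [L fL]] := pcoefP f.
have m0' : (0 : rat) < m%:R by rewrite ltr0n.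
have vm : v * m%:R \is a Num.int by have [] := fL _ fv.
have fn q : f q != 0 -> (q - v) * m%:R \is a Num.nat.
  move=> fq; rewrite natrEint mulrBl rpredB//=; last by have [] := fL _ fq.
  rewrite -mulrBl mulr_ge0// subr_ge0 leNgt.
  by apply/negP => /f0 fq0; rewrite fq0 eqxx in fq.
have [|w wP] := @convol_inverse (fun n => f (v + n%:R / m%:R)).
  by rewrite mul0r addr0.
pose gc (q : rat) : K := if (q + v) * m%:R \is a Num.nat
  then w (Num.truncn ((q + v) * m%:R)) else 0.
have gcn q : gc q != 0 -> (q + v) * m%:R \is a Num.nat.
  by rewrite /gc; case: ifP; rewrite ?eqxx.
have gP : exists2 m, (0 < m)%N & laurent_root m gc.
  exists m => //; exists (- v) => q /gcn; rewrite natrEint => /andP[qm].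
  rewrite pmulr_lge0// -lerBlDr sub0r => ->; split => //.
  by rewrite -(addrK v q) mulrBl rpredB.
exists (Puiseux gP); rewrite mulrC; apply: puiseux_eqP => q.
rewrite pcoefM pcoef1 -/(conv f gc q).
have [/natrP[n qn]|nq] := boolP (q * m%:R \is a Num.nat); last first.
  rewrite (@convE [::])//.
    rewrite big_nil; case: eqP => // q0; move: nq.
    by rewrite q0 mul0r rpred0.
  move=> a /fn am /gcn gm; move: nq.
  by rewrite -[q](subrK a) -[X in X + a](addrK v) -addrA [- v + a]addrC mulrDl rpredD.
have qE : q = n%:R / m%:R by rewrite -qn mulfK// gt_eqF.
rewrite (@convE [seq v + i%:R / m%:R | i <- iota 0 n.+1]).
- rewrite big_map -[iota _ _]/(index_iota 0 n.+1) big_mkord qE.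
  rewrite mulf_eq0 invr_eq0 (gt_eqF m0') orbF pnatr_eq0 -wP.
  apply: eq_bigr => i _; congr (_ * _).
  rewrite /gc [X in X * m%:R](_ : _ = (n - i)%:R / m%:R).
    by rewrite mulfVK ?gt_eqF// rpred_nat natrK.
  by rewrite natrB -1?ltnS// mulrBl opprD addrA addrAC subrK.
- rewrite map_inj_uniq ?iota_uniq// => i j /addrI/(mulIf _)/eqP.
  by rewrite invr_eq0 gt_eqF// eqr_nat => /(_ isT)/eqP.
- move=> a /fn/natrP[i ai] /gcn/natrP[j aj].
  have aE : a = v + i%:R / m%:R by rewrite -ai mulfK ?gt_eqF// subrKC.
  apply/mapP; exists i => //; rewrite mem_iota add0n ltnS leq0n/= -(ler_nat rat) -qn -ai.
  by have := ler0n rat j; rewrite -aj; nra.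
Qed.

Definition puiseux_inv f : puiseux K := xget 0 [set g | g * f = 1].

Fact puiseux_mulVf f : f != 0 -> puiseux_inv f * f = 1.
Proof.
move=> /puiseux_inverse ex.
by have := xgetPex (0 : puiseux K) (ex : exists g, [set g | g * f = 1] g).
Qed.

Fact puiseux_inv0 : puiseux_inv 0 = 0.
Proof.
by apply: xgetPN => g /= /eqP; rewrite mulr0 eq_sym oner_eq0.
Qed.

HB.instance Definition _ := GRing.ComNzRing_isField.Build (puiseux K)
  puiseux_mulVf puiseux_inv0.

Definition lead f : K := f (pval f).

Lemma lead0 : lead 0 = 0. Proof. by rewrite /lead pcoef0. Qed.

Lemma lead_eq0 f : (lead f == 0) = (f == 0).
Proof.
by have [->|/pvalP[/negbTE]//] := eqVneq f 0; rewrite lead0 eqxx.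
Qed.

Lemma is_valM f g q r : is_val f q -> is_val g r -> is_val (f * g) (q + r).
Proof.
move=> [fq q0] [gr r0]; split.
  rewrite pcoefM -/(conv f g _) (@convE [:: q])//.
    by rewrite big_seq1 addrAC subrr add0r mulf_neq0.
  move=> a fa ga; rewrite inE; apply: contraT => aq.
  have : a < q \/ q + r - a < r by lra.
  by case=> [/q0 f0|/r0 g0]; [rewrite f0 eqxx in fa|rewrite g0 eqxx in ga].
move=> x xqr; rewrite pcoefM -/(conv f g _) (@convE [::]) ?big_nil// => a fa ga.
have : a < q \/ x - a < r by lra.
by case=> [/q0 f0|/r0 g0]; [rewrite f0 eqxx in fa|rewrite g0 eqxx in ga].
Qed.

Lemma pvalM f g : f != 0 -> g != 0 -> pval (f * g) = pval f + pval g.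
Proof. by move=> /pvalP fv /pvalP gv; apply/pvalE/is_valM. Qed.

Lemma leadM f g : lead (f * g) = lead f * lead g.
Proof.
have [->|f0] := eqVneq f 0; first by rewrite mul0r lead0 mul0r.
have [->|g0] := eqVneq g 0; first by rewrite mulr0 lead0 mulr0.
rewrite /lead pvalM//; have [fq q0] := pvalP f0; have [gr r0] := pvalP g0.
rewrite pcoefM -/(conv f g _) (@convE [:: pval f])//.
  by rewrite big_seq1 addrAC subrr add0r.
move=> a fa ga; rewrite inE; apply: contraT => aq.
have : a < pval f \/ pval f + pval g - a < pval g by lra.
by case=> [/q0 f0'|/r0 g0']; [rewrite f0' eqxx in fa|rewrite g0' eqxx in ga].
Qed.

Lemma is_valN f q : is_val f q -> is_val (- f) q.
Proof.
by case=> fq q0; split=> [|r /q0 fr]; rewrite pcoefN ?oppr_eq0// fr oppr0.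
Qed.

Lemma leadN f : lead (- f) = - lead f.
Proof.
have [->|f0] := eqVneq f 0; first by rewrite oppr0 lead0 oppr0.
by rewrite /lead (pvalE (is_valN (pvalP f0))).
Qed.

End Field.

Section Order.
Variable K : realFieldType.
Implicit Types f g : puiseux K.

Definition puiseux_lt f g : bool := 0 < lead (g - f).
Definition puiseux_le f g : bool := (f == g) || puiseux_lt f g.
Definition puiseux_norm f : puiseux K := if puiseux_le 0 f then f else - f.

Lemma puiseux_le0E f : puiseux_le 0 f = (0 <= lead f).
Proof. by rewrite /puiseux_le /puiseux_lt subr0 le_eqVlt !(eq_sym 0) lead_eq0. Qed.

Fact puiseux_le0_add f g :
  puiseux_le 0 f -> puiseux_le 0 g -> puiseux_le 0 (f + g).
Proof.
have [->|f0] := eqVneq f 0; first by rewrite add0r.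
have [->|g0] := eqVneq g 0; first by rewrite addr0.
rewrite !puiseux_le0E ![0 <= lead _]le_eqVlt !(eq_sym 0) !lead_eq0 (negbTE f0) (negbTE g0)/=.
rewrite /lead; move=> lf lg; apply/orP; right.
have [fq q0] := pvalP f0; have [gr r0] := pvalP g0.
have [fg|gf|fg] := ltgtP (pval f) (pval g).
- rewrite (@pvalE _ _ (pval f)) ?pcoefD ?(r0 _ fg) ?addr0//.
  split=> [|r rf]; rewrite pcoefD; first by rewrite (r0 _ fg) addr0.
  by rewrite q0// r0 ?addr0// (lt_trans rf).
- rewrite (@pvalE _ _ (pval g)) ?pcoefD ?(q0 _ gf) ?add0r//.
  split=> [|r rg]; rewrite pcoefD; first by rewrite (q0 _ gf) add0r.
  by rewrite r0// q0 ?addr0// (lt_trans rg).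
- move: gr r0 lg; rewrite -fg => gr r0 lg.
  rewrite (@pvalE _ _ (pval f)) ?pcoefD ?addr_gt0//.
  split=> [|r rf]; rewrite pcoefD; first by rewrite gt_eqF// addr_gt0.
  by rewrite q0// r0 ?addr0.
Qed.

Fact puiseux_le0_mul f g :
  puiseux_le 0 f -> puiseux_le 0 g -> puiseux_le 0 (f * g).
Proof. by rewrite !puiseux_le0E leadM; apply: mulr_ge0. Qed.

Fact puiseux_sub_ge0 f g : puiseux_le 0 (g - f) = puiseux_le f g.
Proof. by rewrite /puiseux_le /puiseux_lt subr0 eq_sym subr_eq0 eq_sym. Qed.

Fact puiseux_le0_anti f : puiseux_le 0 f -> puiseux_le f 0 -> f = 0.
Proof.
rewrite -[puiseux_le f 0]puiseux_sub_ge0 sub0r !puiseux_le0E leadN oppr_ge0 => f1 f2.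
by apply/eqP; rewrite -lead_eq0 eq_le f1 f2.
Qed.

Fact puiseux_le0_total f : puiseux_le 0 f || puiseux_le f 0.
Proof.
rewrite -[puiseux_le f 0]puiseux_sub_ge0 sub0r !puiseux_le0E leadN oppr_ge0.
exact: le_total.
Qed.

Fact puiseux_normN f : puiseux_norm (- f) = puiseux_norm f.
Proof.
rewrite /puiseux_norm !puiseux_le0E leadN oppr_ge0 opprK.
case: ltgtP => //= /esym/eqP; rewrite eq_sym lead_eq0 => /eqP->.
by rewrite oppr0.
Qed.

Fact puiseux_ge0_norm f : puiseux_le 0 f -> puiseux_norm f = f.
Proof. by rewrite /puiseux_norm => ->. Qed.

Fact puiseux_lt_def f g : puiseux_lt f g = (g != f) && puiseux_le f g.
Proof.
rewrite /puiseux_le [g == f]eq_sym; case: eqVneq => //= ->.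
by rewrite /puiseux_lt subrr lead0 ltxx.
Qed.

HB.instance Definition _ := Num.IntegralDomain_isLeReal.Build (puiseux K)
  puiseux_le0_add puiseux_le0_mul puiseux_le0_anti puiseux_sub_ge0
  puiseux_le0_total puiseux_normN puiseux_ge0_norm puiseux_lt_def.

Lemma puiseux_ltE f g : (f < g) = (0 < lead (g - f)). Proof. by []. Qed.

End Order.

Definition symm_mx (F : nzRingType) (n : nat) : set 'M[F]_n :=
  [set A | A^T = A].
Arguments symm_mx F n : clear implicits.

Definition principal_minor (F : comNzRingType) (n : nat) (A : 'M[F]_n)
    (I : {set 'I_n}) : F :=
  \det (mxsub (@enum_val _ (mem I)) (@enum_val _ (mem I)) A).

Definition psd (F : realFieldType) (n : nat) : set 'M[F]_n :=
  [set A | symm_mx F n A /\ forall I : {set 'I_n}, 0 <= principal_minor A I].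
Arguments psd F n : clear implicits.

Definition psd_nz (F : realFieldType) (n : nat) : set 'M[F]_n :=
  [set A | psd F n A /\ forall i j, A i j != 0].
Arguments psd_nz F n : clear implicits.

Definition trop_psd (K : realFieldType) (n : nat) : set 'M[rat]_n :=
  [set map_mx (@pval K) A | A in psd_nz (puiseux K) n].
Arguments trop_psd K n : clear implicits.

Definition trop_term (n : nat) (x : 'M[rat]_n) (s : 'S_n) : rat :=
  \sum_i x i (s i).

Definition trop_det (n : nat) (x : 'M[rat]_n) : rat :=
  trop_term x [arg min_(s < (1 : 'S_n)%g) trop_term x s]%O.

Definition polyhedral_cone_in (F : realFieldType) (V : lmodType F)
    (W C : set V) : Prop :=
  exists (m : nat) (l : 'I_m -> {linear V -> F^o}),
    C = [set x | W x /\ forall k, 0 <= l k x :> F].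

Definition conic_hull (F : realFieldType) (V : lmodType F) (s : seq V) :
    set V :=
  [set x | exists2 c : 'I_(size s) -> F,
     forall k, 0 <= c k & x = \sum_k c k *: s`_k].

(* the largest linear subspace of a convex cone *)
Definition lineality (V : zmodType) (C : set V) : set V :=
  [set x | C x /\ C (- x)].

(* e_ij; for i = j there is a single 1 *)
Definition esymm (n : nat) (i j : 'I_n) : 'M[rat]_n :=
  \matrix_(k, l) (((k == i) && (l == j)) || ((k == j) && (l == i)))%:R.

Definition rays (n : nat) : seq 'M[rat]_n :=
  [seq esymm p.1 p.2 | p <- enum {: 'I_n * 'I_n} & p.1 != p.2].

Definition lineality_gens (n : nat) : seq 'M[rat]_n :=
  [seq 2 *: esymm i i + \sum_(j < n | j != i) esymm i j | i <- enum 'I_n].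

(* Main.v *)
(* If [h ^ 2 <= f g] over the Puiseux series then [val f + val g <= 2 val h], so
   the 2 x 2 principal minors give [x_ii + x_jj <= 2 x_ij]. Conversely, given
   these inequalities, the matrix with entries [n! t^(x_ii)] on the diagonal and
   [t^(x_ij)] off it is PSD: by the inequalities each Leibniz term of a k x k
   principal minor, apart from its numerical factor, is at most the product of
   the [t^(x_ii)], and the identity term carries a factor [(n!)^k], against at
   most [(n!)^(k-1)] for each of the fewer than [n!] others.
   Everything else concerns the cone [x_ii + x_jj <= 2 x_ij]: averaging over the
   cycles of a permutation yields the tropical determinant, and the generators
   come from [x = (x - w) + w] with [w_ij = (x_ii + x_jj) / 2]. *)

From HB Require Import structures.
Require Import Defs.
From mathcomp Require Import all_boot all_order all_fingroup all_algebra.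
From mathcomp Require Import all_classical all_reals all_analysis.
From mathcomp Require Import lra ring.

Import Order.TTheory GRing.Theory Num.Theory.
Import numFieldNormedType.Exports.

Local Open Scope classical_set_scope.
Local Open Scope ring_scope.

(** * Multiples and monomials of Puiseux series *)

Lemma pcoefMn (K : zmodType) (f : puiseux K) (m : nat) (q : rat) :
  (f *+ m) q = f q *+ m.
Proof. by elim: m => [|m IH]; rewrite ?mulr0n// !mulrS pcoefD IH. Qed.

(** Coefficients live in characteristic zero, so no leading coefficient is killed. This lets the
    factor [n!] on the diagonal leave valuations unchanged. *)
Lemma is_valMn (K : realFieldType) (f : puiseux K) (q : rat) (m : nat) :
  (0 < m)%N -> is_val f q -> is_val (f *+ m) q.
Proof.
move=> m0 [fq f0]; split=> [|r /f0 fr]; rewrite pcoefMn ?fr ?mul0rn//.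
by rewrite mulrn_eq0 negb_or -lt0n m0.
Qed.

Section Monomial.
Variable K : realFieldType.

Lemma puiseux_monom_subproof (q : rat) :
  exists2 m, (0 < m)%N & laurent_root m (fun r => (r == q)%:R : K).
Proof.
(* The only exponent is [q], so its denominator serves as the common one. *)
exists `|denq q|%N; first by rewrite absz_gt0 denq_neq0.
exists q => r; have [->|] := eqVneq r q; last by rewrite eqxx.
split=> //; rewrite -[_%:R]/((`|denq q|%N)%:Z%:~R) gez0_abs ?denq_ge0//.
by rewrite -numqE intr_int.
Qed.

Definition puiseux_monom (q : rat) : puiseux K :=
  Puiseux (puiseux_monom_subproof q).

Lemma is_val_monom (q : rat) : is_val (puiseux_monom q) q.
Proof.
split=> [|r rq] /=; first by rewrite eqxx oner_neq0.
by rewrite lt_eqF.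
Qed.

Lemma puiseux_monom_gt0 (q : rat) : 0 < puiseux_monom q.
Proof.
by rewrite puiseux_ltE subr0 /lead (Defs.pvalE (is_val_monom q)) /= eqxx.
Qed.

Lemma puiseux_monomD (q r : rat) :
  puiseux_monom (q + r) = puiseux_monom q * puiseux_monom r.
Proof.
apply: puiseux_eqP => s; rewrite pcoefM -/(Defs.conv _ _ s) (@convE _ [:: q])//.
  by rewrite big_seq1 /= eqxx mul1r subr_eq [r + q]addrC.
by move=> a /=; rewrite inE; case: (a == q); rewrite ?eqxx.
Qed.

(** The variable [t] is a positive infinitesimal: for [q < r] the difference [t^q - t^r] has leading
    term [t^q]. *)
Lemma puiseux_monom_le (q r : rat) : q <= r -> puiseux_monom r <= puiseux_monom q.
Proof.
rewrite le_eqVlt => /predU1P[->//|qr]; apply/ltW.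
rewrite puiseux_ltE /lead (@Defs.pvalE _ _ q).
  by rewrite pcoefB /= eqxx (lt_eqF qr) subr0.
split=> [|s sq]; rewrite pcoefB /=.
  by rewrite eqxx (lt_eqF qr) subr0 oner_neq0.
by rewrite (lt_eqF sq) (lt_eqF (lt_trans sq qr)) subrr.
Qed.

End Monomial.

(** * Tropical PSD matrices and the 2 x 2 inequalities *)

(** By contraposition: if [2 val h < val f + val g], then [f g - h^2] has valuation [2 val h] and
    leading coefficient minus a nonzero square, hence is negative. *)
Lemma pval_mul_le (K : realFieldType) (f g h : puiseux K) :
  f != 0 -> g != 0 -> h != 0 -> h ^+ 2 <= f * g ->
  Defs.pval f + Defs.pval g <= 2 * Defs.pval h.
Proof.
move=> f0 g0 h0; rewrite -subr_ge0 -[0 <= _]/(puiseux_le 0 _) puiseux_le0E.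
rewrite leNgt; apply: contraLR; rewrite -ltNge negbK => fgh.
have [fgq fgv] := is_valM (pvalP f0) (pvalP g0).
have [hq hv] := is_valM (pvalP h0) (pvalP h0).
have hfg : Defs.pval h + Defs.pval h < Defs.pval f + Defs.pval g by lra.
rewrite /lead (@Defs.pvalE _ _ (Defs.pval h + Defs.pval h)).
  rewrite pcoefB fgv// sub0r oppr_lt0 expr2 lt_neqAle eq_sym hq /=.
  by have := sqr_ge0 (lead h); rewrite expr2 -leadM /lead pvalM.
rewrite expr2; split=> [|r rh]; rewrite pcoefB.
  by rewrite fgv// sub0r oppr_eq0.
by rewrite fgv ?hv ?subrr// (lt_trans rh).
Qed.

(* The identity term [C ^ k] outweighs the other permutations, each of which
   contributes at most [C ^ (k - 1)]. *)
Lemma det_ge0_dominant (F : realDomainType) (k : nat) (C : F) (d : 'I_k -> F)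
    (A : 'M[F]_k) :
  (k`!)%:R <= C -> (forall i, 0 <= d i) -> (forall i, A i i = C * d i ^+ 2) ->
  (forall i j, i != j -> `|A i j| <= d i * d j) -> 0 <= \det A.
Proof.
move=> kC d0 Aii Aij.
have C1 : 1 <= C by apply: le_trans kC; rewrite ler1n fact_gt0.
have C0 : 0 <= C by rewrite (le_trans ler01).
pose D := \prod_i d i ^+ 2.
have D0 : 0 <= D by rewrite prodr_ge0// => i _; rewrite sqr_ge0.
have prodD (s : 'S_k) : \prod_i (d i * d (s i)) = D.
  have ds : \prod_i d (s i) = \prod_i d i by rewrite [RHS](reindex_perm s).
  by rewrite big_split /= ds -big_split.
rewrite /determinant (bigD1 1%g)//= odd_perm1 expr0 mul1r.
under eq_bigr do rewrite perm1 Aii.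
rewrite big_split /= prodr_const card_ord -/D.
have termP (s : 'S_k) : s != 1%g ->
    `|(-1) ^+ s * \prod_i A i (s i)| <= C ^+ k.-1 * D.
  move=> s1; rewrite normrMsign normr_prod.
  have [i0 si0] : exists i, s i != i.
    apply/existsP; apply: contraR s1; rewrite negb_exists => /forallP si.
    by apply/eqP/permP => i; rewrite perm1; apply/eqP; have := si i; rewrite negbK.
  (* Every row may contribute a factor [C], except the moved row [i0], whose off-diagonal entry
     needs none; this leaves [C ^ (k - 1)]. *)
  apply: (@le_trans _ _ (\prod_i ((if i != i0 then C else 1) * (d i * d (s i))))).
    apply: ler_prod => i _; rewrite normr_ge0 /=.
    have dd : 0 <= d i * d (s i) by rewrite mulr_ge0.
    have [si|si] := eqVneq (s i) i.
      have -> : i != i0 by apply: contraNneq si0 => <-; rewrite si.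
      by rewrite si Aii normrM !ger0_norm ?sqr_ge0// expr2.
    rewrite (le_trans (Aij _ _ _)) 1?eq_sym//.
    by case: ifP => _; rewrite ?mul1r// ler_peMl.
  rewrite big_split /= prodD -big_mkcond /= prodr_const cardC1 card_ord.
  exact: lexx.
(* The identity [C * C ^ k.-1 = C ^ k] requires [0 < k]; for [k = 0] there is no permutation besides
   the identity. *)
have [k0|k0] := posnP k.
  rewrite [X in _ + X]big1 ?addr0 ?mulr_ge0 ?exprn_ge0// => s /eqP[].
  by apply/permP => -[i ik]; exfalso; rewrite k0 in ik.
have : `|\sum_(s | s != 1%g :> 'S_k) (-1) ^+ s * \prod_i A i (s i)|
    <= C ^+ k * D.
  apply: (le_trans (ler_norm_sum _ _ _)).
  (* Counting the identity too gives [k!] equal bounds, and [k! <= C]. *)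
  apply: (@le_trans _ _ (\sum_(s : 'S_k) C ^+ k.-1 * D)).
    rewrite big_mkcond; apply: ler_sum => s _; case: ifP => [/termP//|_].
    by rewrite mulr_ge0 ?exprn_ge0.
  rewrite sumr_const card_Sn -mulr_natl mulrA.
  by rewrite ler_wpM2r// -[X in _ <= C ^+ X](prednK k0) exprS ler_wpM2r ?exprn_ge0.
by rewrite ler_norml => /andP[h _]; rewrite -lerBlDl sub0r.
Qed.

Lemma det_mx22 (F : comNzRingType) (A : 'M[F]_2) :
  \det A = A 0 0 * A 1 1 - A 0 1 * A 1 0.
Proof.
rewrite (expand_det_row _ 0) !big_ord_recl big_ord0 /cofactor !det_mx11 !mxE.
have -> : lift 0 0 = 1 :> 'I_2 by apply/val_inj.
have -> : lift 1 0 = 0 :> 'I_2 by apply/val_inj.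
by rewrite /= addn0 expr0 expr1; ring.
Qed.

Lemma principal_minor_pair (F : realFieldType) (n : nat) (A : 'M[F]_n)
    (i j : 'I_n) : i != j -> A^T = A ->
  principal_minor A [set i; j]%SET = A i i * A j j - A i j ^+ 2.
Proof.
move=> ij AT.
have At k l : A k l = A l k by rewrite -[in LHS]AT mxE.
have c2 : #|mem [set i; j]%SET| = 2%N by rewrite -[LHS]/#|[set i; j]%SET| cards2 ij.
rewrite /principal_minor.
(* The type of [enum_val] depends on the cardinal, so it is generalized with its two properties
   before the cardinal becomes 2. Whether it lists [i] or [j] first stays open; both orders give the
   same minor. *)
move: (@enum_val _ _) (@enum_val_inj _ (mem [set i; j]%SET)) (@enum_valP _ (mem [set i; j]%SET)).
rewrite c2 => e einj eP; rewrite det_mx22 !mxE.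
have := eP 0; have := eP 1; rewrite !inE.
have : e 0 != e 1 by rewrite (inj_eq einj).
move=> e01 /orP[] /eqP e1 /orP[] /eqP e0; move: e01; rewrite e0 e1 ?eqxx// => _.
  by rewrite [A j i]At; ring.
by rewrite [A j i]At; ring.
Qed.

(** The common form to which each description in the theorem is compared. *)
Definition trop_cone (n : nat) : set 'M[rat]_n :=
  [set x | symm_mx rat n x /\
           forall i j : 'I_n, i != j -> x i i + x j j <= 2 * x i j].

Lemma trop_psd_cone (K : realFieldType) (n : nat) :
  trop_psd K n = trop_cone n.
Proof.
apply/seteqP; split=> [_ [A [[AT Amin] A0] <-]|x [xT xle]].
  split=> [|i j ij].
    by apply/matrixP => i j; rewrite !mxE -[in LHS]AT mxE.
  rewrite !mxE; apply: pval_mul_le => //.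
  by rewrite -subr_ge0 -principal_minor_pair.
pose T := @puiseux_monom K.
have T0 q : 0 < T q := puiseux_monom_gt0 K q.
exists (\matrix_(i, j) if i == j then T (x i i) *+ n`! else T (x i j)); last first.
  apply/matrixP => i j; rewrite !mxE; case: eqVneq => [<-|_].
    by apply/Defs.pvalE/is_valMn; [exact: fact_gt0|exact: is_val_monom].
  exact/Defs.pvalE/is_val_monom.
have xC i j : x i j = x j i by rewrite -[in LHS]xT mxE.
split; last first.
  move=> i j; rewrite mxE; case: ifP => _; last exact: lt0r_neq0.
  by rewrite lt0r_neq0// pmulrn_lgt0 ?fact_gt0.
split=> [|I]; first by apply/matrixP => i j; rewrite !mxE eq_sym xC; case: eqVneq => [->|].
rewrite /principal_minor; set e := enum_val.
(* With [d_k = t^(x_kk / 2)] the diagonal is [n! d_k^2], and [x_kk + x_ll <= 2 x_kl] says exactly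
   that [t^(x_kl) <= d_k d_l]. *)
apply: (@det_ge0_dominant _ _ (n`!%:R) (fun k => T (x (e k) (e k) / 2))).
- by rewrite ler_nat leq_fact// -[X in (_ <= X)%N]card_ord max_card.
- by move=> i; exact: ltW.
- by move=> i; rewrite !mxE eqxx mulr_natl expr2 -puiseux_monomD -splitr.
- move=> i j ij; rewrite !mxE (inj_eq (@enum_val_inj _ _)) (negbTE ij).
  rewrite gtr0_norm// -puiseux_monomD puiseux_monom_le//.
  have : e i != e j by rewrite (inj_eq (@enum_val_inj _ _)).
  by move=> /xle; lra.
Qed.

(** * The tropical determinant *)

Lemma trop_det_eq1P (n : nat) (x : 'M[rat]_n) :
  trop_term x (1 : 'S_n)%g = trop_det x <->
  forall s : 'S_n, trop_term x (1 : 'S_n)%g <= trop_term x s.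
Proof.
rewrite /trop_det; case: arg_minP => // s _ smin; split=> [-> t|xmin].
  exact: smin.
by apply: le_anti; rewrite xmin smin.
Qed.

Lemma trop_det_cone (n : nat) :
  [set x : 'M[rat]_n |
     symm_mx rat n x /\ trop_term x (1 : 'S_n)%g = trop_det x] = trop_cone n.
Proof.
apply/seteqP; split=> x [xT]; rewrite ?trop_det_eq1P => xle; split=> //.
  (* Minimality is tested on a transposition, whose term differs from that of the identity only in
     rows [i] and [j]. *)
  move=> i j ij; have := xle (tperm i j); rewrite /trop_term.
  rewrite (bigD1 i)//= (bigD1 j) 1?eq_sym//= [X in _ <= X](bigD1 i)//=.
  rewrite [X in _ <= _ + X](bigD1 j) 1?eq_sym//= tpermL tpermR !perm1.
  rewrite [X in _ + (_ + X) <= _](_ : _ =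
    \sum_(k < n | (k != i) && (k != j)) x k (tperm i j k)); last first.
    apply: eq_bigr => k /andP[ki kj].
    by rewrite perm1 tpermD// eq_sym.
  rewrite !addrA lerD2r; suff -> : x j i = x i j by lra.
  by rewrite -[in LHS]xT mxE.
apply/trop_det_eq1P => s; rewrite /trop_term.
under eq_bigr do rewrite perm1.
(* Since [s] permutes the indices, the trace is a sum of averages over [i] and [s i], each at most
   [x i (s i)]. *)
have -> : \sum_i x i i = \sum_i (x i i / 2 + x (s i) (s i) / 2).
  have xs : \sum_i x (s i) (s i) = \sum_i x i i by rewrite [RHS](reindex_perm s).
  by rewrite big_split /= -!mulr_suml xs; lra.
apply: ler_sum => i _; have [<-|si] := eqVneq i (s i); first by lra.
by have := xle _ _ si; lra.
Qed.

(** * Polyhedrality and closedness *)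

Section Slack.
Variable n : nat.

Definition slack (i j : 'I_n) (x : 'M[rat]_n) : rat^o :=
  2 * x i j - (x i i + x j j).

Lemma slack_linear (i j : 'I_n) : linear (slack i j).
Proof. by move=> a x y; rewrite /slack !mxE /GRing.scale /=; ring. Qed.

HB.instance Definition _ (i j : 'I_n) :=
  GRing.isLinear.Build rat 'M[rat]_n rat^o _ (slack i j) (slack_linear i j).

(** The form [slack i i] is zero, so the inequalities can be indexed by the finite type of all
    pairs. *)
Lemma trop_coneE :
  trop_cone n =
  [set x | symm_mx rat n x /\ forall p : 'I_n * 'I_n, 0 <= slack p.1 p.2 x :> rat].
Proof.
apply/seteqP; split=> x [xT xle]; split=> //.
  move=> [i j] /=; rewrite /slack subr_ge0.
  by have [<-|/xle//] := eqVneq i j; lra.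
by move=> i j _; rewrite -subr_ge0; exact: xle (i, j).
Qed.

Lemma polyhedral_trop_cone : polyhedral_cone_in (symm_mx rat n) (trop_cone n).
Proof.
pose e (k : 'I_#|{: 'I_n * 'I_n}|) := enum_val k.
exists #|{: 'I_n * 'I_n}|, (fun k => slack (e k).1 (e k).2).
rewrite trop_coneE; apply/seteqP; split=> x [xT xle]; split=> // p; first exact: xle.
by rewrite -(enum_rankK p); exact: xle.
Qed.

(** Symmetry and the inequalities are preimages of a point and of a closed half-line under
    continuous functions of the entries. *)
Lemma closed_trop_cone : closed (trop_cone n : set 'M[rat^o]_n).
Proof.
have -> : (trop_cone n : set 'M[rat^o]_n) = \bigcap_(p : 'I_n * 'I_n)
   ((fun x : 'M[rat^o]_n => (x p.1 p.2 : rat^o) - x p.2 p.1) @^-1` [set 0] `&`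
    (slack p.1 p.2 : 'M[rat^o]_n -> rat^o) @^-1` [set q : rat^o | 0 <= q]).
  rewrite trop_coneE; apply/seteqP; split=> x /=.
    move=> [xT xle] p _; split=> //=; apply/eqP; rewrite subr_eq0.
    by rewrite -[in X in _ == X]xT mxE.
  move=> xP; split=> [|p]; last by have [] := xP p I.
  apply/matrixP => i j; rewrite mxE.
  by have [/= /eqP + _] := xP (j, i) I; rewrite subr_eq0 => /eqP.
have coord i j : continuous (fun x : 'M[rat^o]_n => x i j : rat^o).
  exact: coord_continuous.
apply: closed_bigI => p _; apply: closedI.
  apply: closed_comp; last exact: closed_eq.
  by move=> x _; exact: (cvgB (coord p.1 p.2 x) (coord p.2 p.1 x)).
apply: closed_comp; last exact: closed_ge.
move=> x _; exact: (cvgB (cvgM (cvg_cst _) (coord p.1 p.2 x))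
                         (cvgD (coord p.1 p.1 x) (coord p.2 p.2 x))).
Qed.

End Slack.

Arguments slack {n}.

(** * Generating rays and the lineality space *)

Section ConicHull.
Variables (F : realFieldType) (V : lmodType F) (s : seq V).

Lemma conic_hull0 : conic_hull s 0.
Proof. by exists (fun=> 0) => //; rewrite big1// => k _; rewrite scale0r. Qed.

Lemma conic_hullD (x y : V) :
  conic_hull s x -> conic_hull s y -> conic_hull s (x + y).
Proof.
move=> [c c0 ->] [d d0 ->]; exists (fun k => c k + d k).
  by move=> k; rewrite addr_ge0.
by rewrite -big_split; apply: eq_bigr => k _; rewrite scalerDl.
Qed.

Lemma conic_hull_mem (c : F) (x : V) :
  0 <= c -> x \in s -> conic_hull s (c *: x).
Proof.
move=> c0 xs; have ix : (index x s < size s)%N by rewrite index_mem.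
exists (fun k => if k == Ordinal ix then c else 0) => [k|]; first by case: ifP.
rewrite (bigD1 (Ordinal ix))//= eqxx nth_index// big1 ?addr0// => k /negbTE->.
by rewrite scale0r.
Qed.

End ConicHull.

Section Generators.
Variable n : nat.

(** The generator is the matrix [[v_k + v_l]] of the [i]-th unit vector [v]; the factor 2 supplies
    its entry at [(i, i)]. *)
Lemma lineality_genE (i : 'I_n) :
  2 *: esymm i i + \sum_(j < n | j != i) esymm i j =
  \matrix_(k, l) ((k == i)%:R + (l == i)%:R).
Proof.
apply/matrixP => k l; rewrite !mxE summxE orbb.
under eq_bigr do rewrite mxE.
have [->|ki] := eqVneq k i; have [->|li] := eqVneq l i => /=.
- rewrite big1 ?addr0 ?mulr1// => j ji.
  by rewrite andbT ![i == j]eq_sym (negbTE ji).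
- rewrite (bigD1 l)//= eqxx big1 ?addr0 ?mulr0 ?add0r// => j /andP[_ jl].
  by rewrite andbF orbF eq_sym (negbTE jl).
- rewrite (bigD1 k)//= eqxx big1 ?addr0 ?mulr0 ?add0r// => j /andP[_ jk].
  by rewrite andbT eq_sym (negbTE jk).
- by rewrite big1 ?mulr0 ?addr0// => j _; rewrite andbF.
Qed.

(** A projection onto the lineality space: the matrix with the diagonal of [x] on which every
    [slack] vanishes. *)
Definition half_diag (x : 'M[rat]_n) : 'M[rat]_n :=
  \matrix_(k, l) ((x k k + x l l) / 2).

Lemma half_diag_span (x : 'M[rat]_n) :
  half_diag x \in <<lineality_gens n>>%VS.
Proof.
have -> : half_diag x = \sum_i (x i i / 2) *:
    (2 *: esymm i i + \sum_(j < n | j != i) esymm i j).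
  have delta (k : 'I_n) : \sum_i (x i i / 2) * (k == i)%:R = x k k / 2.
    rewrite (bigD1 k)//= eqxx mulr1 big1 ?addr0// => i ik.
    by rewrite eq_sym (negbTE ik) mulr0.
  apply/matrixP => k l; rewrite summxE mxE mulrDl -!delta -big_split /=.
  by apply: eq_bigr => i _; rewrite lineality_genE !mxE mulrDr.
apply: rpred_sum => i _; apply/rpredZ/memv_span/mapP.
by exists i; rewrite ?mem_enum.
Qed.

(** Being fixed by [half_diag] is a linear condition, so it is enough to check multiples of the
    generators and sums. *)
Lemma lineality_spanP (x : 'M[rat]_n) :
  x \in <<lineality_gens n>>%VS <-> x = half_diag x.
Proof.
split=> [xs|->]; last exact: half_diag_span.
rewrite (coord_span (X := in_tuple (lineality_gens n)) xs).
apply: (big_ind (fun y => y = half_diag y)) => [|y z|i _].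
- by apply/matrixP => k l; rewrite !mxE addr0 mul0r.
- move=> yE zE; apply/matrixP => k l.
  by rewrite mxE [in LHS]yE [in LHS]zE !mxE; ring.
- have /mapP[j _ ->] : (lineality_gens n)`_i \in lineality_gens n.
    exact/mem_nth.
  by apply/matrixP => k l; rewrite lineality_genE !mxE; lra.
Qed.

Lemma half_diag_cone (x : 'M[rat]_n) : x = half_diag x -> trop_cone n x.
Proof.
move=> xE; split=> [|i j _].
  by rewrite /symm_mx /= xE; apply/matrixP => i j; rewrite !mxE addrC.
by rewrite {3}xE mxE; lra.
Qed.

Lemma trop_cone0 : trop_cone n 0.
Proof. by apply/half_diag_cone/matrixP => i j; rewrite !mxE addr0 mul0r. Qed.

Lemma trop_coneD (x y : 'M[rat]_n) :
  trop_cone n x -> trop_cone n y -> trop_cone n (x + y).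
Proof.
move=> [xT xle] [yT yle]; split=> [|i j ij].
  by rewrite /symm_mx /= linearD /= xT yT.
by rewrite !mxE; have := xle _ _ ij; have := yle _ _ ij; lra.
Qed.

Lemma trop_coneZ (c : rat) (x : 'M[rat]_n) :
  0 <= c -> trop_cone n x -> trop_cone n (c *: x).
Proof.
move=> c0 [xT xle]; split=> [|i j ij].
  by rewrite /symm_mx /= linearZ /= xT.
by rewrite !mxE; have := xle _ _ ij; nra.
Qed.

Lemma ray_cone (x : 'M[rat]_n) : x \in rays n -> trop_cone n x.
Proof.
move=> /mapP[[i j]]; rewrite mem_filter /= => /andP[ij _] ->.
split=> [|k l _].
  apply/matrixP => k l; rewrite !mxE orbC.
  by rewrite [(l == i) && _]andbC [(l == j) && _]andbC.
have diag0 m : esymm i j m m = 0.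
  by rewrite mxE; case: eqVneq => [->|]; rewrite ?(negbTE ij) ?andbF.
by rewrite !diag0 mxE addr0 mulr_ge0.
Qed.

Lemma conic_hull_rays_cone (x : 'M[rat]_n) :
  conic_hull (rays n) x -> trop_cone n x.
Proof.
move=> [c c0 ->]; apply: big_ind => [|y z|k _]; first exact: trop_cone0.
  exact: trop_coneD.
by apply/trop_coneZ/ray_cone => //; exact: mem_nth.
Qed.

(** The difference has zero diagonal and entries [slack k l x / 2 >= 0], which become the
    coefficients of the rays. *)
Lemma trop_cone_sub_half_diag (x : 'M[rat]_n) :
  trop_cone n x -> conic_hull (rays n) (x - half_diag x).
Proof.
rewrite trop_coneE => -[xT xle].
(* The denominator is [4]: each ray [e_ij = e_ji] occurs twice in the sum. *)
have -> : x - half_diag x =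
    \sum_(p : 'I_n * 'I_n) (slack p.1 p.2 x / 4 : rat) *: esymm p.1 p.2.
  have delta (q : 'I_n * 'I_n) :
      \sum_p slack p.1 p.2 x / 4 * (p == q)%:R = slack q.1 q.2 x / 4 :> rat.
    rewrite (bigD1 q)//= eqxx mulr1 big1 ?addr0// => p /negbTE->.
    by rewrite mulr0.
  apply/matrixP => k l; rewrite summxE.
  transitivity (slack k l x / 4 + slack l k x / 4 : rat).
    rewrite /slack !mxE; suff -> : x l k = x k l by lra.
    by rewrite -[in LHS]xT mxE.
  rewrite -(delta (k, l)) -(delta (l, k)) -big_split; apply: eq_bigr => -[i j] _ /=.
  rewrite !mxE -mulrDr !xpair_eqE.
  (* For [i != j] the entry of [e_ij] is a sum of two indicators. For [i = j] it is not, but the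
     coefficient is zero. *)
  have [<-|ij] := eqVneq i j.
    by rewrite (_ : slack _ _ _ = 0) ?mul0r// /slack; lra.
  congr (_ * _); rewrite [i == k]eq_sym [j == l]eq_sym [i == l]eq_sym [j == k]eq_sym.
  have [->|_] := eqVneq k i; first by rewrite (negbTE ij) andbF orbF addr0.
  by rewrite add0r andbC.
apply: big_ind => [|y z|[i j] _]; first exact: conic_hull0.
  exact: conic_hullD.
have [<-|ij] := eqVneq i j => /=.
  by rewrite (_ : slack _ _ _ = 0) ?mul0r ?scale0r; [exact: conic_hull0|rewrite /slack; lra].
apply: conic_hull_mem; first by rewrite divr_ge0// (xle (i, j)).
by apply/mapP; exists (i, j); rewrite // mem_filter ij mem_enum.
Qed.

Lemma trop_cone_generated :
  trop_cone n = [set u + w | u in conic_hull (rays n) &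
                             w in [set` <<lineality_gens n>>%VS]].
Proof.
apply/seteqP; split=> [x xc|_ [u uc [w wl <-]]].
  exists (x - half_diag x); first exact: trop_cone_sub_half_diag.
  by exists (half_diag x); [exact: half_diag_span|rewrite subrK].
apply: trop_coneD; first exact: conic_hull_rays_cone.
exact/half_diag_cone/lineality_spanP.
Qed.

(** If [x] and [-x] both lie in the cone, every [slack] is zero, which says that [half_diag] fixes
    [x]. *)
Lemma lineality_trop_cone :
  lineality (trop_cone n) = [set` <<lineality_gens n>>%VS].
Proof.
apply/seteqP; split=> x /=; rewrite lineality_spanP.
  rewrite /lineality !trop_coneE => -[[_ xge] [_ xle]].
  apply/matrixP => k l; rewrite mxE; have := xge (k, l); have := xle (k, l).
  by rewrite /slack !mxE /=; lra.
move=> xE; split; apply: half_diag_cone => //.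
by apply/matrixP => k l; rewrite mxE [in LHS]xE !mxE; lra.
Qed.

End Generators.

Theorem theorem2p1 (R : realType) (n : nat) (n_gt0 : (0 < n)%N) :
  [/\ trop_psd R n =
        [set x : 'M[rat]_n |
           symm_mx rat n x /\ trop_term x (1 : 'S_n)%g = trop_det x],

      trop_psd R n =
        [set x : 'M[rat]_n |
           symm_mx rat n x /\
           forall i j : 'I_n, i != j -> x i i + x j j <= 2 * x i j],

      polyhedral_cone_in (symm_mx rat n) (trop_psd R n) /\
      closed (trop_psd R n : set 'M[rat^o]_n),

      trop_psd R n =
        [set u + w | u in conic_hull (rays n) &
                     w in [set` <<lineality_gens n>>%VS]] &

      lineality (trop_psd R n) = [set` <<lineality_gens n>>%VS] ].
Proof.
rewrite trop_psd_cone; split.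
- by rewrite trop_det_cone.
- by [].
- by split; [exact: polyhedral_trop_cone|exact: closed_trop_cone].
- exact: trop_cone_generated.
- exact: lineality_trop_cone.
Qed.
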